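(* Let $\Omega\subset\mathbb{R}^2$ be a domain with coordinates $x,y$, and let $r:\Omega\to S^5\subset\mathbb{C}^3$ be a horizontal map such that $\varphi=\mathcal{H}\circ r:\Omega\to\mathbb{C}P^2$ is a conformal Lagrangian immersion. Let $2e^{v}(dx^2+dy^2)$ be the induced metric on the surface $\varphi(\Omega)$, and let $\beta(x,y)$ be the Lagrangian angle, defined by $$e^{i\beta}=dz_1\wedge dz_2\wedge dz_3(\sigma),$$ where $z_1,z_2,z_3$ are the coordinates in $\mathbb{C}^3$ and $\sigma$ is the frame formed by the vectors $r,\ \frac{r_x}{|r_x|},\ \frac{r_y}{|r_y|}$. Then the components $r_j$, $j=1,2,3$, of the vector function $r$ satisfy the Schr\''odinger equation $$Lr_j=\partial_x^2r_j+\partial_y^2r_j-i\left(\beta_x\partial_xr_j+\beta_y\partial_yr_j\right)+4e^vr_j=0.$$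
   Context: $S^5$ is the unit sphere in $\mathbb{C}^3$, and $\mathcal{H}:S^5\to\mathbb{C}P^2$ is the Hopf bundle; $\mathbb{C}P^2$ carries the Fubini--Study metric for which $\mathcal{H}$ is a Riemannian submersion. All maps are smooth. An immersion into $\mathbb{C}P^2$ is Lagrangian if the pullback of the Fubini--Study form vanishes. With $\langle\cdot,\cdot\rangle$ the Hermitian product in $\mathbb{C}^3$, $r$ is horizontal if $\langle r,r_x\rangle=\langle r,r_y\rangle=0$; in this case, for a conformal Lagrangian immersion, $\langle r_x,r_y\rangle=0$ and $|r_x|^2=|r_y|^2=2e^v$. The number $dz_1\wedge dz_2\wedge dz_3(\sigma)$ is the complex determinant of the $3\times3$ matrix whose rows are the three vectors of $\sigma$; it has modulus $1$. The function $\beta$ is real-valued and (locally) smooth, determined up to an additive multiple of $2\pi$. Subscripts $x,y$ denote partial derivatives. *)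

(* Defs.v *)
From HB Require Import structures.
From mathcomp Require Import all_boot all_order all_algebra.
From mathcomp Require Import all_classical all_reals all_analysis.
From mathcomp Require Import complex.

Set Implicit Arguments.
Unset Strict Implicit.
Unset Printing Implicit Defensive.

Import Order.TTheory GRing.Theory Num.Theory.
Import numFieldNormedType.Exports.

Local Open Scope classical_set_scope.
Local Open Scope ring_scope.
Local Open Scope complex_scope.
Local Open Scope sesquilinear_scope.

Section Calculus.
Variable R : realType.

Definition dirx : R * R := (1, 0).
Definition diry : R * R := (0, 1).

(* A function on [Omega] is represented by a total function on [R * R] of which
   only the values on [Omega] matter; [Omega] is always open below. *)
Fixpoint Ck (n : nat) (Omega : set (R * R)) (f : R * R -> R) : Prop :=
  match n with
  | 0 => forall p, Omega p -> {for p, continuous f}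
  | m.+1 => [/\ forall p, Omega p -> differentiable f p,
                Ck m Omega (fun p => 'D_dirx f p) &
                Ck m Omega (fun p => 'D_diry f p)]
  end.

Definition smooth_on (Omega : set (R * R)) (f : R * R -> R) : Prop :=
  forall n, Ck n Omega f.

(* [R[i]] is not a normed [R]-module in the library, so real directional
   derivatives of complex functions are taken on real and imaginary parts. *)
Definition dC (a : R * R) (f : R * R -> R[i]) (p : R * R) : R[i] :=
  'D_a (fun q => complex.Re (f q)) p +i* 'D_a (fun q => complex.Im (f q)) p.

Definition dM m n (a : R * R) (F : R * R -> 'M[R[i]]_(m, n)) (p : R * R) :
    'M[R[i]]_(m, n) :=
  \matrix_(i, j) dC a (fun q => F q i j) p.

Definition smooth_mx_on m n (Omega : set (R * R))
    (F : R * R -> 'M[R[i]]_(m, n)) : Prop :=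
  forall i j, smooth_on Omega (fun q => complex.Re (F q i j)) /\
              smooth_on Omega (fun q => complex.Im (F q i j)).

Definition expi (t : R) : R[i] := cos t +i* sin t.

End Calculus.

(* The library's Hermitian product on row vectors,
   <u, v> = \sum_j u_j * conj v_j, linear in [u]. *)
Notation "''[' u , v ]" := (dotmx u v) : ring_scope.

Section Geometry.
Variable R : realType.
Local Notation C := R[i].

Definition cnorm (u : 'rV[C]_3) : R := Num.sqrt (complex.Re '[u, u]).

Definition S5 : set 'rV[C]_3 := [set z | '[z, z] = 1].

(* CP^2 is realised as the submanifold of 'M_3(C) of orthogonal projectors onto
   complex lines, [z] in S^5 being sent to the projector
   u |-> u *m hopf z = <u, z> z  onto the line C z. *)
Definition CP2 : set 'M[C]_3 :=
  [set P | [/\ P ^t* = P, P *m P = P & \tr P = 1]].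

Definition hopf (z : 'rV[C]_3) : 'M[C]_3 := z ^t* *m z.

(* The differential of [hopf] at [z]. *)
Definition dhopf (z w : 'rV[C]_3) : 'M[C]_3 := w ^t* *m z + z ^t* *m w.

(* Tangent vectors of CP^2 are matrices; the factor 1/2 makes [hopf] a
   Riemannian submersion (see [hopf_submersion]). *)
Definition fs_metric (X Y : 'M[C]_3) : R := complex.Re (\tr (X *m Y)) / 2.

(* The complex structure of T_P CP^2, see [cp2_J_hopf]. *)
Definition cp2_J (P X : 'M[C]_3) : 'M[C]_3 := 'i%C *: (P *m X - X *m P).

Definition fs_form (P X Y : 'M[C]_3) : R := fs_metric (cp2_J P X) Y.

(* Maps phi : Omega -> CP^2; [a] and [b] are tangent vectors of R^2. *)
Definition pullback_metric (phi : R * R -> 'M[C]_3) (p a b : R * R) : R :=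
  fs_metric (dM a phi p) (dM b phi p).

Definition pullback_form (phi : R * R -> 'M[C]_3) (p a b : R * R) : R :=
  fs_form (phi p) (dM a phi p) (dM b phi p).

Definition dot2 (a b : R * R) : R := a.1 * b.1 + a.2 * b.2.

Definition immersion (Omega : set (R * R)) (phi : R * R -> 'M[C]_3) : Prop :=
  forall p, Omega p -> forall a, dM a phi p = 0 -> a = 0.

Definition conformal (Omega : set (R * R)) (phi : R * R -> 'M[C]_3) : Prop :=
  forall p, Omega p -> exists2 l : R, 0 < l &
    forall a b, pullback_metric phi p a b = l * dot2 a b.

Definition lagrangian (Omega : set (R * R)) (phi : R * R -> 'M[C]_3) : Prop :=
  forall p, Omega p -> forall a b, pullback_form phi p a b = 0.

(* The induced metric is 2 e^v (dx^2 + dy^2). *)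
Definition induced_metric (Omega : set (R * R)) (phi : R * R -> 'M[C]_3)
    (v : R * R -> R) : Prop :=
  forall p, Omega p -> forall a b,
    pullback_metric phi p a b = 2 * expR (v p) * dot2 a b.

Definition horizontal (Omega : set (R * R)) (r : R * R -> 'rV[C]_3) : Prop :=
  forall p, Omega p ->
    '[r p, dM (dirx R) r p] = 0 /\ '[r p, dM (diry R) r p] = 0.

Definition normalize (u : 'rV[C]_3) : 'rV[C]_3 := ((cnorm u)^-1)%:C *: u.

Definition frame (r : R * R -> 'rV[C]_3) (p : R * R) : 'M[C]_3 :=
  \matrix_(k < 3)
    nth 0 [:: r p; normalize (dM (dirx R) r p); normalize (dM (diry R) r p)] k.

(* [beta] is a branch on [U] of the Lagrangian angle. *)
Definition lagrangian_angle (U : set (R * R)) (r : R * R -> 'rV[C]_3)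
    (beta : R * R -> R) : Prop :=
  smooth_on U beta /\ forall p, U p -> expi (beta p) = \det (frame r p).

Definition schrodinger (v beta : R * R -> R) (f : R * R -> C) (p : R * R) : C :=
  dC (dirx R) (dC (dirx R) f) p + dC (diry R) (dC (diry R) f) p
  - 'i%C * (('D_(dirx R) beta p)%:C * dC (dirx R) f p
            + ('D_(diry R) beta p)%:C * dC (diry R) f p)
  + (4 * expR (v p))%:C * f p.

Lemma dotmx_mul (u w : 'rV[C]_3) : u *m w ^t* = '[u, w]%:M.
Proof. by rewrite dotmxE -mx11_scalar. Qed.

Lemma dotmx_tr (u w : 'rV[C]_3) : \tr (w ^t* *m u) = '[u, w].
Proof. by rewrite mxtrace_mulC dotmx_mul mxtrace_scalar mulr1n. Qed.

Lemma dotmxC (u w : 'rV[C]_3) : '[w, u] = Num.conj '[u, w].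
Proof.
rewrite !dotmxE !mxE rmorph_sum; apply: eq_bigr => j _.
by rewrite !mxE rmorphM /= conjCK mulrC.
Qed.

Lemma dotmxZl c (u w : 'rV[C]_3) : '[c *: u, w] = c * '[u, w].
Proof. by rewrite !dotmxE -scalemxAl mxE. Qed.

Lemma trmxCM m n q (A : 'M[C]_(m, n)) (B : 'M[C]_(n, q)) :
  (A *m B) ^t* = B ^t* *m A ^t*.
Proof. by rewrite trmx_mul map_mxM. Qed.

Lemma trmxCZ m n c (A : 'M[C]_(m, n)) : (c *: A) ^t* = Num.conj c *: A ^t*.
Proof. by apply/matrixP => i j; rewrite !mxE rmorphM. Qed.

Lemma trmxC_tr_eq0 (A : 'M[C]_3) : \tr (A *m A ^t*) = 0 -> A = 0.
Proof.
rewrite /mxtrace => /eqP; rewrite psumr_eq0; last first.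
  move=> i _; rewrite mxE; apply: sumr_ge0 => j _.
  by rewrite !mxE mul_conjC_ge0.
move=> /allP A0; apply/matrixP => i j; rewrite [RHS]mxE.
have := A0 i (mem_index_enum _); rewrite /= mxE psumr_eq0; last first.
  by move=> k _; rewrite !mxE mul_conjC_ge0.
move=> /allP/(_ j (mem_index_enum _)); rewrite /= !mxE mul_conjC_eq0.
by move=> /eqP.
Qed.

(* [hopf] maps S^5 onto CP^2 and its fibres are the U(1)-orbits. *)
Lemma hopf_CP2 : hopf @` S5 = CP2.
Proof.
apply/seteqP; split => [_ [z z1 <-]|P [Ph PP P1]].
  split; first by rewrite /hopf trmxCM trmxCK.
    by rewrite /hopf mulmxA -(mulmxA (z ^t*)) dotmx_mul z1 mulmx1.
  by rewrite /hopf dotmx_tr z1.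
have [i Pi] : exists i, row i P != 0.
  apply: contrapT => P0; have : P = 0.
    apply/row_matrixP => i; rewrite row0; apply: contrapT => Pi.
    by apply: P0; exists i; apply/eqP.
  by move=> P0'; move: P1; rewrite P0' linear0 => /eqP; rewrite eq_sym oner_eq0.
set u := row i P in Pi; have u0 := dotmx_is_dotmx Pi.
have uP : u *m P = u by rewrite /u -row_mul PP.
set c := (sqrtC '[u, u])^-1.
have cc : c * Num.conj c * '[u, u] = 1.
  have s0 : 0 <= sqrtC '[u, u] by rewrite sqrtC_ge0 ltW.
  have cR : Num.conj c = c.
    by rewrite /c fmorphV /= geC0_conj.
  rewrite cR /c -[X in _ * X](sqrtCK '[u, u]) expr2.
  have ? : sqrtC '[u, u] != 0 by rewrite sqrtC_eq0 gt_eqF.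
  by rewrite -invfM mulVf// mulf_neq0.
pose z := c *: u.
have z1 : S5 z.
  by rewrite /S5/= dotmxZl dotmxC dotmxZl rmorphM /= -dotmxC mulrA.
have zP : z *m P = z by rewrite /z -scalemxAl uP.
exists z => //.
have Qh : (hopf z) ^t* = hopf z by rewrite /hopf trmxCM trmxCK.
have QP : hopf z *m P = hopf z by rewrite /hopf -mulmxA zP.
have PQ : P *m hopf z = hopf z by rewrite -{1}Ph -{1}Qh -trmxCM QP Qh.
have QQ : hopf z *m hopf z = hopf z.
  by rewrite /hopf mulmxA -(mulmxA (z ^t*)) dotmx_mul z1 mulmx1.
apply/eqP; rewrite eq_sym -subr_eq0; apply/eqP; apply: trmxC_tr_eq0.
have -> : (P - hopf z) ^t* = P - hopf z.
  by rewrite linearB map_mxB Ph Qh.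
rewrite mulmxBl !mulmxBr PP PQ QP QQ subrr subr0 linearB /= P1.
by rewrite /hopf dotmx_tr z1 subrr.
Qed.

Lemma hopf_fibre (z w : 'rV[C]_3) : S5 z -> S5 w ->
  hopf z = hopf w <-> exists2 c : C, `|c| = 1 & w = c *: z.
Proof.
move=> z1 w1; split => [zw|[c c1 ->]]; last first.
  rewrite /hopf trmxCZ -scalemxAl -scalemxAr scalerA.
  by rewrite mulrC -normCK c1 expr1n scale1r.
have wE : w = '[w, z] *: z.
  rewrite -mul_scalar_mx -dotmx_mul -mulmxA -/(hopf z) zw /hopf mulmxA.
  by rewrite dotmx_mul w1 mul1mx.
exists '[w, z] => //; apply/eqP; rewrite -(@pexpr_eq1 _ _ 2)// normCK.
by rewrite -dotmxC -dotmxZl -wE w1.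
Qed.

Lemma hopf_submersion (z w1 w2 : 'rV[C]_3) : S5 z ->
  '[w1, z] = 0 -> '[w2, z] = 0 ->
  fs_metric (dhopf z w1) (dhopf z w2) = complex.Re '[w1, w2].
Proof.
move=> z1 wz1 wz2.
have zw1 : '[z, w1] = 0 by rewrite dotmxC wz1 conjC0.
have zw2 : '[z, w2] = 0 by rewrite dotmxC wz2 conjC0.
rewrite /fs_metric /dhopf mulmxDl !mulmxDr.
rewrite !mulmxA -!(mulmxA _ z) -!(mulmxA _ w1) !dotmx_mul z1 zw2 wz1.
rewrite !mul_mx_scalar !scale0r scale1r !mul0mx addr0 add0r mxtraceD.
rewrite -scalemxAl mxtraceZ !dotmx_tr z1 mulr1.
rewrite (dotmxC w1 w2); case: '[w1, w2] => a b /=.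
by rewrite -mulr2n -[a *+ 2]mulr_natr mulfK// pnatr_eq0.
Qed.

Lemma cp2_J_hopf (z w : 'rV[C]_3) : S5 z -> '[w, z] = 0 ->
  cp2_J (hopf z) (dhopf z w) = dhopf z ('i%C *: w).
Proof.
move=> z1 wz.
have zw : '[z, w] = 0 by rewrite dotmxC wz conjC0.
rewrite /cp2_J /hopf /dhopf !mulmxDr !mulmxDl !mulmxA.
rewrite -!(mulmxA _ z) -!(mulmxA _ w) !dotmx_mul z1 zw wz.
rewrite !mul_mx_scalar !scale0r !scale1r !mul0mx addr0 add0r.
rewrite scalerBr trmxCZ -scalemxAl -scalemxAr addrC.
congr (_ + _); rewrite -scaleNr; congr (_ *: _).
by apply/eqP; rewrite eq_complex /= oppr0 !eqxx.
Qed.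

End Geometry.

(* Main.v *)
Require Import Defs.
From HB Require Import structures.
From mathcomp Require Import all_boot all_order all_algebra.
From mathcomp Require Import all_classical all_reals all_analysis.
From mathcomp Require Import complex.
From mathcomp Require Import perm ring.

Set Implicit Arguments.
Unset Strict Implicit.
Unset Printing Implicit Defensive.

Import Order.TTheory GRing.Theory Num.Theory.
Import numFieldNormedType.Exports.

Local Open Scope classical_set_scope.
Local Open Scope ring_scope.
Local Open Scope complex_scope.

(** Put E = 2 e^v.  The hypotheses on [r] say that (r, r_x, r_y) is a frame of
    C^3 which is orthogonal for the Hermitian product, with squared lengths
    1, E, E: horizontality gives the products with r, and the Hermitian product
    of two horizontal vectors has the pulled-back metric as real part and minus
    the pulled-back symplectic form, which vanishes, as imaginary part
    ([dotmx_pullback]).  It is therefore enough to find the three Hermitian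
    products of Delta r = r_xx + r_yy with the frame.

    - With r: differentiating <r_x, r> = 0 along x gives <r_xx, r> = - E, and
      likewise for y, so <Delta r, r> = - 2 E ([normal_second_derivative]).

    - With r_x: the determinant D of the frame is E e^(i beta), the factor E
      being the product of the lengths of r_x and r_y ([det_frame]).  By
      Jacobi's formula D_x / D is the trace of the derivative of the frame
      against its inverse; for an orthogonal frame the inverse is the conjugate
      transpose up to the squared lengths, whence

        <r_xx, r_x> + <r_xy, r_y> = E_x + i beta_x E    ([angle_derivative]).

      On the other hand, differentiating E = <r_y, r_y> along x and
      0 = <r_y, r_x> along y gives E_x = <r_xy, r_y> - <r_yy, r_x>.
      The terms <r_xy, r_y> and E_x cancel and
      <Delta r, r_x> = i beta_x E remains ([laplacian_tangential]).

    - With r_y: the same with x and y exchanged.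

    So Delta r = - 2 E r + i (beta_x r_x + beta_y r_y), which is the equation,
    since 2 E = 4 e^v.  The second item depends on r_xy = r_yx
    ([derive_mixed_sym]), which follows from the mean value theorem applied to a
    second difference. *)

(** * Symmetry of mixed directional derivatives *)

Section MixedPartials.
Variables (R : realType) (V : normedModType R).
Implicit Types (f : V -> R) (p a b : V) (t l : R).

(** Reduces directional derivatives to ordinary ones, so that the mean value
    theorem and the chain rule of one real variable apply. *)
Lemma is_derive_lineE f p a t l :
  is_derive (p + t *: a) a f l <->
  is_derive t (1 : R) (fun s => f (p + s *: a)) l.
Proof.
pose g (s : R) := f (p + s *: a); rewrite -/g.
have E : (fun h => h^-1 *: ((f \o shift (p + t *: a)) (h *: a)
                            - f (p + t *: a))) =
         (fun h => h^-1 *: ((g \o shift t) (h *: (1 : R)) - g t)).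
  apply/funext => h /=; congr (_ *: (f _ - _)).
  by rewrite [h *: 1]mulr1 scalerDl addrCA.
have dvE : derivable f (p + t *: a) a = derivable g t (1 : R).
  by rewrite /derivable E.
have dE : 'D_a f (p + t *: a) = 'D_1 g t by rewrite /derive E.
split=> -[fd fl].
  by apply: DeriveDef; [rewrite -dvE|rewrite -dE].
by apply: DeriveDef; [rewrite dvE|rewrite dE].
Qed.

Lemma is_derive_comp_dir (g : R -> R) f p a (k l : R) :
  is_derive (f p) (1 : R) g k -> is_derive p a f l ->
  is_derive p a (g \o f) (k * l).
Proof.
move=> gk fl; rewrite -[p]addr0 -[X in p + X](scale0r a).
apply/is_derive_lineE.
apply: (@is_derive1_comp R g (fun s : R => f (p + s *: a))).
  by rewrite scale0r addr0.
by apply/is_derive_lineE; rewrite scale0r addr0.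
Qed.

(** The mean value theorem is applied twice: along [a] to the difference of [f]
    across the [b]-side of the parallelogram, then along [b] to ['D_a f]. *)
Lemma second_difference_MVT f p a b t (N : set V) : 0 < t ->
  (forall s u, 0 <= s <= t -> 0 <= u <= t -> N (p + s *: a + u *: b)) ->
  (forall q, N q -> derivable f q a) ->
  (forall q, N q -> derivable ('D_a f) q b) ->
  exists2 q, N q &
  f (p + t *: a + t *: b) - f (p + t *: a) - (f (p + t *: b) - f p) =
  t * (t * 'D_b ('D_a f) q).
Proof.
move=> t0 Npab fa fab.
have t00 : 0 <= t <= t by rewrite lexx ltW.
have Npa s : 0 <= s <= t -> N (p + s *: a).
  move=> st; rewrite -[_ + _]addr0 -(scale0r b).
  by apply: Npab => //; rewrite lexx ltW.
pose g s := f (p + s *: a + t *: b) - f (p + s *: a).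
pose dg s := 'D_a f (p + s *: a + t *: b) - 'D_a f (p + s *: a).
have gd s : 0 <= s <= t -> is_derive s (1 : R) g (dg s).
  move=> st; apply: is_deriveB; last first.
    by apply/is_derive_lineE/derivableP/fa/Npa.
  have -> : (fun s => f (p + s *: a + t *: b)) =
            (fun s => f (p + t *: b + s *: a)).
    by apply/funext => x; rewrite addrAC.
  apply/is_derive_lineE; rewrite addrAC.
  exact/derivableP/fa/Npab.
have [|||s st gE] := @MVT R g dg 0 t.
- by [].
- by move=> s; rewrite in_itv/= => /andP[s0 s1]; apply: gd; rewrite !ltW.
- apply: derivable_within_continuous => s; rewrite in_itv/= => st.
  exact: (@ex_derive _ _ _ _ _ _ _ (gd s st)).
have {}st : 0 <= s <= t.
  by move: st; rewrite in_itv/= => /andP[? ?]; rewrite !ltW.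
pose h u := 'D_a f (p + s *: a + u *: b).
have hd u : 0 <= u <= t ->
    is_derive u (1 : R) h ('D_b ('D_a f) (p + s *: a + u *: b)).
  move=> ut.
  apply: (iffLR (is_derive_lineE ('D_a f) (p + s *: a) b u _)).
  exact/derivableP/fab/Npab.
have [|||u ut hE] :=
  @MVT R h (fun u => 'D_b ('D_a f) (p + s *: a + u *: b)) 0 t.
- by [].
- by move=> u; rewrite in_itv/= => /andP[s0 s1]; apply: hd; rewrite !ltW.
- apply: derivable_within_continuous => u; rewrite in_itv/= => ut.
  exact: (@ex_derive _ _ _ _ _ _ _ (hd u ut)).
have {}ut : 0 <= u <= t.
  by move: ut; rewrite in_itv/= => /andP[? ?]; rewrite !ltW.
exists (p + s *: a + u *: b); first exact: Npab.
move: gE hE; rewrite /g /h /dg !subr0 !scale0r !addr0 => -> ->.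
by rewrite mulrC [X in t * X]mulrC.
Qed.

Lemma small_parallelogram p a b (N : set V) : nbhs p N ->
  exists2 t : R, 0 < t &
  forall s u, 0 <= s <= t -> 0 <= u <= t -> N (p + s *: a + u *: b).
Proof.
move=> /nbhs_ballP[e /= e0 eN].
have m0 : 0 < `|a| + `|b| + 1 by rewrite ltr_wpDl// addr_ge0.
(* The summand 1 keeps the denominator positive when a = b = 0. *)
exists (e / (`|a| + `|b| + 1)); first by rewrite divr_gt0.
move=> s u /andP[s0 st] /andP[u0 ut]; apply: eN.
rewrite -ball_normE /ball_/= -addrA opprD addrA subrr sub0r normrN.
apply: (le_lt_trans (ler_normD _ _)); rewrite !normrZ !ger0_norm//.
apply: (@le_lt_trans _ _ (e / (`|a| + `|b| + 1) * (`|a| + `|b|))).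
  by rewrite mulrDr lerD// ler_wpM2r.
rewrite -mulrA gtr_pMr// mulrC ltr_pdivrMr// mul1r.
by rewrite ltrDl.
Qed.

(** The second difference of [f] on a small parallelogram is symmetric in [a]
    and [b], so [second_difference_MVT] expresses it both through
    ['D_b ('D_a f)] and through ['D_a ('D_b f)], at two points close to [p];
    continuity concludes. *)
Theorem derive_mixed_sym f p a b (N : set V) : nbhs p N ->
  (forall q, N q -> derivable f q a /\ derivable f q b) ->
  (forall q, N q -> derivable ('D_a f) q b /\ derivable ('D_b f) q a) ->
  {for p, continuous ('D_b ('D_a f))} -> {for p, continuous ('D_a ('D_b f))} ->
  'D_b ('D_a f) p = 'D_a ('D_b f) p.
Proof.
move=> pN f1 f2 cba cab; apply/eqP; rewrite -subr_eq0 -normr_le0.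
apply/ler_addgt0Pr => e e0; rewrite add0r.
have close (x y z : R) :
    `|x - z| < e / 2 -> `|y - z| < e / 2 -> `|x - y| <= e.
  move=> /ltW xz /ltW yz; apply: (le_trans (ler_distD z x y)).
  by rewrite [leRHS]splitr [`|z - y|]distrC lerD.
have e20 : 0 < e / 2 by rewrite divr_gt0.
move/cvgrPdist_lt : cba => /(_ _ e20) cba.
move/cvgrPdist_lt : cab => /(_ _ e20) cab.
have [t t0 tN] := small_parallelogram a b (filterI pN (filterI cba cab)).
have [||q [_ [q1 _]] qE] := second_difference_MVT t0 tN (f := f).
- by move=> q [/f1[]].
- by move=> q [/f2[]].
have tN' s u : 0 <= s <= t -> 0 <= u <= t ->
    (N `&` [set q | `|'D_b ('D_a f) p - 'D_b ('D_a f) q| < e / 2]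
       `&` [set q | `|'D_a ('D_b f) p - 'D_a ('D_b f) q| < e / 2])
    (p + s *: b + u *: a).
  by move=> st ut; rewrite addrAC -setIA; exact: tN.
have [||q' [_ q'1] q'E] := second_difference_MVT t0 tN' (f := f).
- by move=> q' [[/f1[]]].
- by move=> q' [[/f2[]]].
have swap (A B D E : R) : A - B - (D - E) = A - D - (B - E) by ring.
have qq' : 'D_b ('D_a f) q = 'D_a ('D_b f) q'.
  apply/(mulfI (lt0r_neq0 t0))/(mulfI (lt0r_neq0 t0)).
  apply: (etrans (esym qE)); apply: (etrans _ q'E).
  by rewrite -(addrAC p (t *: a)); exact: swap.
have {}q1 : `|'D_b ('D_a f) p - 'D_b ('D_a f) q| < e / 2 by exact: q1.
have {}q'1 : `|'D_a ('D_b f) p - 'D_b ('D_a f) q| < e / 2.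
  by rewrite qq'; exact: q'1.
exact: close q1 q'1.
Qed.
End MixedPartials.

(** * Directional derivatives of complex and matrix valued functions *)

Section ComplexDerivative.
Local Open Scope sesquilinear_scope.
Variables (R : realType) (V : normedModType R).
Local Notation C := R[i].
Implicit Types (f g : V -> C) (p a : V) (k l : C).

(** The relational counterpart of [dC]: it carries the existence of the
    derivative along with its value, as the rules for sums and products need. *)
Definition is_dC a p f l :=
  is_derive p a (fun q => complex.Re (f q)) (complex.Re l) /\
  is_derive p a (fun q => complex.Im (f q)) (complex.Im l).

Lemma is_dC_unique a p f k l : is_dC a p f k -> is_dC a p f l -> k = l.
Proof.
case: k l => [k1 k2] [l1 l2] [/= [_ <-] [_ <-]] [[_ /= ->] [_ /= ->]] //.
Qed.

Lemma is_dC_near a p f g l :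
  (\near p, f p = g p) -> is_dC a p f l -> is_dC a p g l.
Proof.
by move=> fg [f1 f2]; split;
  [apply: near_eq_is_derive f1|apply: near_eq_is_derive f2];
  apply: filterS fg => q ->.
Qed.

Lemma is_dC_cst a p k : is_dC a p (fun=> k) 0.
Proof. by split; exact: is_derive_cst. Qed.

Lemma is_dCD a p f g k l : is_dC a p f k -> is_dC a p g l ->
  is_dC a p (fun q => f q + g q) (k + l).
Proof.
move=> [f1 f2] [g1 g2]; split.
  have -> : (fun q => complex.Re (f q + g q)) =
            (fun q => complex.Re (f q)) + (fun q => complex.Re (g q)).
    by apply/funext => q; rewrite raddfD.
  by rewrite raddfD; exact: is_deriveD.
have -> : (fun q => complex.Im (f q + g q)) =
          (fun q => complex.Im (f q)) + (fun q => complex.Im (g q)).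
  by apply/funext => q; rewrite raddfD.
by rewrite raddfD; exact: is_deriveD.
Qed.

Lemma is_dCM a p f g k l : is_dC a p f k -> is_dC a p g l ->
  is_dC a p (fun q => f q * g q) (k * g p + f p * l).
Proof.
have ReM (z w : C) : complex.Re (z * w) =
    complex.Re z * complex.Re w - complex.Im z * complex.Im w.
  by case: z w => [? ?] [].
have ImM (z w : C) : complex.Im (z * w) =
    complex.Re z * complex.Im w + complex.Im z * complex.Re w.
  by case: z w => [? ?] [].
move=> [f1 f2] [g1 g2]; split.
  have -> : (fun q => complex.Re (f q * g q)) =
      (fun q => complex.Re (f q)) * (fun q => complex.Re (g q)) -
      (fun q => complex.Im (f q)) * (fun q => complex.Im (g q)).
    by apply/funext => q; exact: ReM.
  apply: (is_derive_eq (is_deriveB (is_deriveM f1 g1) (is_deriveM f2 g2))).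
  case: k l (f p) (g p) {f1 f2 g1 g2} => [? ?] [? ?] [? ?] [? ?] /=.
  by rewrite /GRing.scale /=; ring.
have -> : (fun q => complex.Im (f q * g q)) =
    (fun q => complex.Re (f q)) * (fun q => complex.Im (g q)) +
    (fun q => complex.Im (f q)) * (fun q => complex.Re (g q)).
  by apply/funext => q; exact: ImM.
apply: (is_derive_eq (is_deriveD (is_deriveM f1 g2) (is_deriveM f2 g1))).
case: k l (f p) (g p) {f1 f2 g1 g2} => [? ?] [? ?] [? ?] [? ?] /=.
by rewrite /GRing.scale /=; ring.
Qed.

Lemma is_dC_conj a p f k :
  is_dC a p f k -> is_dC a p (fun q => Num.conj (f q)) (Num.conj k).
Proof.
have ReE (z : C) : complex.Re (Num.conj z) = complex.Re z by case: z.
have ImE (z : C) : complex.Im (Num.conj z) = - complex.Im z by case: z.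
move=> [f1 f2]; split.
  by rewrite ReE; under eq_fun do rewrite ReE.
by rewrite ImE; under eq_fun do rewrite ImE; exact: is_deriveN.
Qed.

Lemma is_dC_sum (I : finType) a p (f : I -> V -> C) (k : I -> C) :
  (forall i, is_dC a p (f i) (k i)) ->
  is_dC a p (fun q => \sum_i f i q) (\sum_i k i).
Proof.
move=> fk; elim: (index_enum I) => [|i e IH].
  by rewrite big_nil; under eq_fun do rewrite big_nil; exact: is_dC_cst.
by rewrite big_cons; under eq_fun do rewrite big_cons; exact: is_dCD.
Qed.

(** Leibniz rule; factor [j] is the differentiated one, in the form in which it
    becomes the row replacement of [is_dC_det]. *)
Lemma is_dC_prod n a p (f : 'I_n -> V -> C) (k : 'I_n -> C) :
  (forall i, is_dC a p (f i) (k i)) ->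
  is_dC a p (fun q => \prod_i f i q)
    (\sum_j \prod_i (if i == j then k i else f i p)).
Proof.
elim: n f k => [|n IH] f k fk.
  rewrite big_ord0; under eq_fun do rewrite big_ord0; exact: is_dC_cst.
under eq_fun do rewrite big_ord_recl; rewrite big_ord_recl.
have := is_dCM (fk ord0) (IH _ _ (fun i => fk (lift ord0 i))).
congr is_dC; congr (_ + _).
  by rewrite big_ord_recl eqxx.
rewrite big_distrr; apply: eq_bigr => j _; rewrite big_ord_recl /=.
by congr (_ * _); apply: eq_bigr.
Qed.

Lemma expi_neq0 (t : R) : expi t != 0.
Proof.
apply/eqP => -[c s]; have := cos2Dsin2 t.
by rewrite c s expr0n addr0 => /eqP; rewrite eq_sym oner_eq0.
Qed.

Lemma is_dC_expi a p (f : V -> R) (l : R) : is_derive p a f l ->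
  is_dC a p (fun q => expi (f q)) ('i%C * l%:C * expi (f p)).
Proof.
move=> fl; split.
  apply: (is_derive_eq (is_derive_comp_dir (is_derive_cos (f p)) fl)).
  by rewrite /=; ring.
apply: (is_derive_eq (is_derive_comp_dir (is_derive_sin (f p)) fl)).
by rewrite /=; ring.
Qed.

Definition is_dM m n a p (F : V -> 'M[C]_(m, n)) (L : 'M[C]_(m, n)) :=
  forall i j, is_dC a p (fun q => F q i j) (L i j).

Lemma is_dM_trmxC m n a p (F : V -> 'M[C]_(m, n)) L :
  is_dM a p F L -> is_dM a p (fun q => (F q) ^t*) (L ^t*).
Proof.
move=> FL i j; rewrite !mxE; under eq_fun do rewrite !mxE.
exact: is_dC_conj.
Qed.

Lemma is_dM_mulmx m n r a p (F : V -> 'M[C]_(m, n)) (G : V -> 'M[C]_(n, r))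
    K L : is_dM a p F K -> is_dM a p G L ->
  is_dM a p (fun q => F q *m G q) (K *m G p + F p *m L).
Proof.
move=> FK GL i j; rewrite !mxE -big_split; under eq_fun do rewrite mxE.
by apply: is_dC_sum => s; apply: is_dCM.
Qed.

Lemma is_dC_dotmx a p (F G : V -> 'rV[C]_3) K L :
  is_dM a p F K -> is_dM a p G L ->
  is_dC a p (fun q => '[F q, G q]) ('[K, G p] + '[F p, L]).
Proof.
move=> FK GL; under eq_fun do rewrite dotmxE.
have := is_dM_mulmx FK (is_dM_trmxC GL).
by move=> /(_ ord0 ord0); rewrite mxE -!dotmxE.
Qed.

(** Jacobi's formula.  By the Leibniz expansion the derivative of a determinant
    is the sum over the rows of the determinants in which that row is replaced
    by its derivative; expanding each along the replaced row gives the cofactors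
    of the original matrix. *)
Lemma is_dC_det n a p (A : V -> 'M[C]_n) L : is_dM a p A L ->
  is_dC a p (fun q => \det (A q)) (\tr (L *m \adj (A p))).
Proof.
move=> AL.
pose Ak (k : 'I_n) : 'M[C]_n :=
  \matrix_(i, j) if i == k then L i j else A p i j.
have -> : \tr (L *m \adj (A p)) = \sum_k \det (Ak k).
  apply: eq_bigr => k _; rewrite (expand_det_row _ k) mxE.
  apply: eq_bigr => j _; rewrite !mxE eqxx; congr (_ * (_ * \det _)).
  by apply/matrixP => i l; rewrite !mxE eq_sym (negbTE (neq_lift _ _)).
rewrite /determinant exchange_big; apply: is_dC_sum => s.
have := is_dC_prod (fun i => AL i (s i)).
move=> /(is_dCM (is_dC_cst a p ((-1) ^+ s))); congr is_dC.
rewrite mul0r add0r big_distrr; apply: eq_bigr => k _; congr (_ * _).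
by apply: eq_bigr => i _; rewrite mxE.
Qed.

End ComplexDerivative.

(** * Orthogonal frames for the Hermitian product *)

Section Frames.
Local Open Scope sesquilinear_scope.
Variable R : realType.
Local Notation C := R[i].

Lemma mulmx_trmxCE m n q (A : 'M[C]_(m, n)) (B : 'M[C]_(q, n)) i j :
  (A *m B ^t*) i j = '[row i A, row j B].
Proof. by rewrite dotmxE !mxE; apply: eq_bigr => k _; rewrite !mxE. Qed.

(** When the rows of [A] are orthogonal, its inverse is the conjugate transpose
    with columns divided by the squared lengths [d]; the adjugate is this inverse
    times the determinant.  Together with [is_dC_det] this turns the logarithmic
    derivative of the determinant into Hermitian products of the rows. *)
Lemma mxtrace_mul_adj_diag_gram n (A B : 'M[C]_n) (d : 'rV[C]_n) :
  A *m A ^t* = diag_mx d -> (forall k, d 0 k != 0) ->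
  \tr (B *m \adj A) = \det A * \sum_k '[row k B, row k A] / d 0 k.
Proof.
move=> AA d0; pose e := map_mx (@GRing.inv _) d.
have de : diag_mx d *m diag_mx e = 1%:M.
  rewrite mulmx_diag -diag_const_mx; congr diag_mx; apply/rowP => k.
  by rewrite !mxE mulfV.
have A1 : (A ^t* *m diag_mx e) *m A = 1%:M by rewrite mulmx1C// mulmxA AA.
have -> : \adj A = \det A *: (A ^t* *m diag_mx e).
  have := congr1 (mulmx (A ^t* *m diag_mx e)) (mul_mx_adj A).
  by rewrite mulmxA A1 mul1mx mul_mx_scalar.
rewrite -scalemxAr mxtraceZ mulmxA; congr (_ * _); apply: eq_bigr => k _.
by rewrite mul_mx_diag mxE mulmx_trmxCE !mxE.
Qed.

Implicit Types (u v w x : 'rV[C]_3).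

Lemma dotmxDl u v w : '[u + v, w] = '[u, w] + '[v, w].
Proof. by rewrite !dotmxE mulmxDl mxE. Qed.

Lemma dotmxBl u v w : '[u - v, w] = '[u, w] - '[v, w].
Proof. by rewrite dotmxDl -scaleN1r dotmxZl mulN1r. Qed.

Lemma dotmx_eq0_sym u v : '[u, v] = 0 -> '[v, u] = 0.
Proof. by move=> uv; rewrite dotmxC uv conjC0. Qed.

Definition rows3 u v w : 'M[C]_3 := \matrix_(k < 3) nth 0 [:: u; v; w] k.

Lemma det_rows3_scale (c d : C) u v w :
  \det (rows3 u (c *: v) (d *: w)) = c * d * \det (rows3 u v w).
Proof.
have -> : rows3 u (c *: v) (d *: w) =
    diag_mx (\row_k nth 0 [:: 1; c; d] k) *m rows3 u v w.
  apply/matrixP => k j; rewrite mul_diag_mx !mxE.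
  by case: k => [[|[|[|]]]] //= _; rewrite ?mul1r ?mxE.
rewrite det_mulmx det_diag !big_ord_recr big_ord0 /= !mxE /=.
by rewrite !mul1r.
Qed.

Lemma rows3_orthogonal u v w (e : C) :
  '[u, u] = 1 -> '[v, v] = e -> '[w, w] = e ->
  '[u, v] = 0 -> '[u, w] = 0 -> '[v, w] = 0 ->
  rows3 u v w *m (rows3 u v w) ^t* = diag_mx (\row_k nth 0 [:: 1; e; e] k).
Proof.
move=> uu vv ww uv uw vw; apply/matrixP => i j.
rewrite mulmx_trmxCE !rowK !mxE.
have entries (f : nat -> nat -> C) :
    f 0%N 0%N = 1 -> f 1%N 1%N = e -> f 2%N 2%N = e ->
    f 0%N 1%N = 0 -> f 0%N 2%N = 0 -> f 1%N 2%N = 0 ->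
    f 1%N 0%N = 0 -> f 2%N 0%N = 0 -> f 2%N 1%N = 0 ->
    f i j = nth 0 [:: 1; e; e] i *+ (i == j).
  by case: i => [[|[|[|]]]] //= ?; case: j => [[|[|[|]]]] //= ?.
exact: (entries (fun i j => '[nth 0 [:: u; v; w] i, nth 0 [:: u; v; w] j])
  uu vv ww uv uw vw
  (dotmx_eq0_sym uv) (dotmx_eq0_sym uw) (dotmx_eq0_sym vw)).
Qed.

(** The three products are the entries of [x] times the conjugate transpose of
    an invertible matrix. *)
Lemma rows3_nondegenerate u v w x : \det (rows3 u v w) != 0 ->
  '[x, u] = 0 -> '[x, v] = 0 -> '[x, w] = 0 -> x = 0.
Proof.
move=> G0 xu xv xw; set G := rows3 u v w in G0.
have GU : G ^t* \in unitmx.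
  by rewrite unitmxE det_map_mx det_tr unitfE conjC_eq0.
rewrite -[x](mulmxK GU); suff -> : x *m G ^t* = 0 by rewrite mul0mx.
have entries (f : nat -> C) (k : 'I_3) :
    f 0%N = 0 -> f 1%N = 0 -> f 2%N = 0 -> f k = 0.
  by case: k => [[|[|[|]]]].
apply/rowP => k; rewrite mulmx_trmxCE row_id rowK mxE.
exact: (entries (fun k => '[x, nth 0 [:: u; v; w] k]) k xu xv xw).
Qed.

(** The difference of the two sides is orthogonal to the three rows. *)
Lemma frame_expansion (u v w d : 'rV[C]_3) (c e s t : C) :
  \det (rows3 u v w) != 0 ->
  '[u, u] = 1 -> '[v, v] = e -> '[w, w] = e ->
  '[u, v] = 0 -> '[u, w] = 0 -> '[v, w] = 0 ->
  '[d, u] = c -> '[d, v] = s * e -> '[d, w] = t * e ->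
  d = c *: u + s *: v + t *: w.
Proof.
move=> G0 uu vv ww uv uw vw du dv dw.
have expand z : '[d - (c *: u + s *: v + t *: w), z] =
    '[d, z] - (c * '[u, z] + s * '[v, z] + t * '[w, z]).
  by rewrite dotmxBl 2!dotmxDl 3!dotmxZl.
apply/eqP; rewrite -subr_eq0; apply/eqP; apply: (rows3_nondegenerate G0).
- by rewrite expand du uu (dotmx_eq0_sym uv) (dotmx_eq0_sym uw); ring.
- by rewrite expand dv uv vv (dotmx_eq0_sym vw); ring.
- by rewrite expand dw uw vw ww; ring.
Qed.

End Frames.

(** * Maps from the plane to the sphere and to the projective plane *)

Section PlaneDerivatives.
Variable R : realType.
Local Notation C := R[i].
Implicit Types (U : set (R * R)) (p a b : R * R).

Lemma dM_is_dM m n a p (F : R * R -> 'M[C]_(m, n)) L :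
  is_dM a p F L -> dM a F p = L.
Proof.
move=> FL; apply/matrixP => i j; rewrite mxE; have [[_ h1] [_ h2]] := FL i j.
by rewrite /dC h1 h2; case: (L i j).
Qed.

Lemma smooth_is_dM m n U a p (F : R * R -> 'M[C]_(m, n)) :
  smooth_mx_on U F -> U p -> is_dM a p F (dM a F p).
Proof.
move=> FU Up i j; rewrite mxE.
have [/(_ 1%N)[h1 _ _] /(_ 1%N)[h2 _ _]] := FU i j.
by split; apply: derivableP; apply: diff_derivable; [exact: h1|exact: h2].
Qed.

Lemma smooth_dM m n U (F : R * R -> 'M[C]_(m, n)) : smooth_mx_on U F ->
  smooth_mx_on U (dM (dirx R) F) /\ smooth_mx_on U (dM (diry R) F).
Proof.
move=> FU; split=> i j; have [h1 h2] := FU i j; split=> k.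
- by under eq_fun do rewrite mxE /=; have [] := h1 k.+1.
- by under eq_fun do rewrite mxE /=; have [] := h2 k.+1.
- by under eq_fun do rewrite mxE /=; have [] := h1 k.+1.
- by under eq_fun do rewrite mxE /=; have [] := h2 k.+1.
Qed.

Lemma smooth_mx_on_sub m n U W (F : R * R -> 'M[C]_(m, n)) :
  U `<=` W -> smooth_mx_on W F -> smooth_mx_on U F.
Proof.
move=> UW FW i j; have Ck_sub k f : Ck k W f -> Ck k U f.
  elim: k f => [|k IH] f /=; first by move=> fW p /UW; exact: fW.
  by move=> [fd fx fy]; split; [move=> p /UW; exact: fd|exact: IH|exact: IH].
by have [h1 h2] := FW i j; split=> k; apply: Ck_sub.
Qed.

Lemma smooth_derive_sym U (f : R * R -> R) p : open U -> U p -> smooth_on U f ->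
  'D_(diry R) ('D_(dirx R) f) p = 'D_(dirx R) ('D_(diry R) f) p.
Proof.
move=> oU Up fU; have [fd [fxd _ fxy] [fyd fyx _]] := fU 2%N.
apply: (@derive_mixed_sym _ _ f p (dirx R) (diry R) U).
- exact: open_nbhs_nbhs.
- by move=> q Uq; split; apply: diff_derivable; exact: fd.
- move=> q Uq; split; apply: diff_derivable; [exact: fxd|exact: fyd].
- exact: fxy.
- exact: fyx.
Qed.

Lemma dM_sym m n U (F : R * R -> 'M[C]_(m, n)) p :
  open U -> U p -> smooth_mx_on U F ->
  dM (diry R) (dM (dirx R) F) p = dM (dirx R) (dM (diry R) F) p.
Proof.
move=> oU Up FU; apply/matrixP => i j; have [h1 h2] := FU i j.
have ReE a : (fun q => complex.Re (dM a F q i j)) =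
    'D_a (fun q => complex.Re (F q i j)).
  by apply/funext => q; rewrite mxE.
have ImE a : (fun q => complex.Im (dM a F q i j)) =
    'D_a (fun q => complex.Im (F q i j)).
  by apply/funext => q; rewrite mxE.
rewrite [LHS]mxE [RHS]mxE /dC !ReE !ImE.
exact: (f_equal2 (@Complex R) (smooth_derive_sym oU Up h1)
  (smooth_derive_sym oU Up h2)).
Qed.

Lemma is_dM_hopf a p (z : R * R -> 'rV[C]_3) w :
  is_dM a p z w -> is_dM a p (@hopf R \o z) (dhopf (z p) w).
Proof. by move=> zw; exact: (is_dM_mulmx (is_dM_trmxC zw) zw). Qed.

(** [hopf] is a Riemannian submersion and intertwines multiplication by i on
    horizontal vectors with the complex structure, so the metric is the real part
    of the Hermitian product, and the symplectic form of wa and wb is the real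
    part of <i wa, wb>, that is, minus the imaginary part of <wa, wb>. *)
Lemma dotmx_pullback a b p (z : R * R -> 'rV[C]_3) wa wb : S5 (z p) ->
  is_dM a p z wa -> is_dM b p z wb -> '[z p, wa] = 0 -> '[z p, wb] = 0 ->
  '[wa, wb] = pullback_metric (@hopf R \o z) p a b
              +i* - pullback_form (@hopf R \o z) p a b.
Proof.
move=> z1 za zb zwa zwb.
have wz w := @dotmx_eq0_sym R (z p) w.
rewrite /pullback_metric /pullback_form /fs_form.
rewrite (dM_is_dM (is_dM_hopf za)) (dM_is_dM (is_dM_hopf zb)).
have iwz : '['i%C *: wa, z p] = 0 by rewrite dotmxZl wz// mulr0.
rewrite [cp2_J _ _](cp2_J_hopf z1 (wz _ zwa)).
rewrite (hopf_submersion z1 (wz _ zwa) (wz _ zwb)).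
rewrite (hopf_submersion z1 iwz (wz _ zwb)) dotmxZl.
by case: '[wa, wb] => x y /=; congr (_ +i* _); ring.
Qed.

Lemma det_frame (r : R * R -> 'rV[C]_3) p (e : R) : 0 < e ->
  '[dM (dirx R) r p, dM (dirx R) r p] = e%:C ->
  '[dM (diry R) r p, dM (diry R) r p] = e%:C ->
  \det (rows3 (r p) (dM (dirx R) r p) (dM (diry R) r p)) =
  e%:C * \det (frame r p).
Proof.
move=> e0 xx yy; pose s := Num.sqrt e.
have xs : cnorm (dM (dirx R) r p) = s by rewrite /cnorm xx.
have ys : cnorm (dM (diry R) r p) = s by rewrite /cnorm yy.
have frameE : frame r p = rows3 (r p) (s^-1%:C *: dM (dirx R) r p)
                                (s^-1%:C *: dM (diry R) r p).
  by rewrite /frame /normalize xs ys.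
have unscale (d : C) : d = e%:C * (s^-1%:C * s^-1%:C * d).
  have ess : e * (s^-1 * s^-1) = 1.
    by rewrite -invfM -expr2 sqr_sqrtr ?ltW// mulfV// lt0r_neq0.
  have essC : e%:C * (s^-1%:C * s^-1%:C) = 1 :> C.
    rewrite -[1]/(1%:C) -ess.
    by apply/eqP; rewrite eq_complex /= !(mul0r, mulr0, subr0, addr0) !eqxx.
  by rewrite [RHS]mulrA essC mul1r.
by rewrite frameE det_rows3_scale; exact: unscale.
Qed.

(** Lets identities valid on an open set be differentiated. *)
Lemma is_dC_open U a p (f g : R * R -> C) k : open U -> U p ->
  (forall q, U q -> f q = g q) -> is_dC a p f k -> is_dC a p g k.
Proof.
move=> oU Up fg; apply: is_dC_near.
have : nbhs p U by exact: open_nbhs_nbhs.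
by apply: filterS => q /fg.
Qed.

(** * Derivatives of the frame and the Lagrangian angle *)

(** Both sides times the unit [expi (beta p)] are the derivative along [c] of the
    determinant of the frame: the right-hand side by the product rule for
    E e^(i beta), the left-hand side by Jacobi's formula for the orthogonal frame
    with squared lengths 1, E, E, in which the row [r] contributes
    <r_c, r> = 0. *)
Lemma angle_derivative U c p (r rx ry : R * R -> 'rV[C]_3) rc rcx rcy
    (E : R * R -> C) Ec (beta : R * R -> R) (l : R) : open U -> U p ->
  (forall q, U q -> [/\ '[r q, r q] = 1, '[rx q, rx q] = E q &
                        '[ry q, ry q] = E q]) ->
  (forall q, U q -> [/\ '[r q, rx q] = 0, '[r q, ry q] = 0 &
                        '[rx q, ry q] = 0]) ->
  (forall q, U q -> \det (rows3 (r q) (rx q) (ry q)) = E q * expi (beta q)) ->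
  E p != 0 ->
  is_dM c p r rc -> is_dM c p rx rcx -> is_dM c p ry rcy ->
  is_dC c p E Ec -> is_derive p c beta l -> '[rc, r p] = 0 ->
  '[rcx, rx p] + '[rcy, ry p] = Ec + 'i%C * l%:C * E p.
Proof.
move=> oU Up gram gram0 detE E0 dr drx dry dE dbeta rcr.
have [rr xx yy] := gram p Up; have [rxp ryp xy] := gram0 p Up.
have orth := rows3_orthogonal rr xx yy rxp ryp xy.
have dG : is_dM c p (fun q => rows3 (r q) (rx q) (ry q)) (rows3 rc rcx rcy).
  move=> i j; rewrite mxE; under eq_fun do rewrite mxE.
  by case: i => [[|[|[|]]]].
have dEe := is_dCM dE (is_dC_expi dbeta).
have := is_dC_unique (is_dC_det dG)
  (is_dC_open oU Up (fun q Uq => esym (detE q Uq)) dEe).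
rewrite (mxtrace_mul_adj_diag_gram _ orth); last first.
  by move=> k; rewrite mxE; case: k => [[|[|[|]]]] //= _; exact: oner_neq0.
have sum3 (f : nat -> C) : \sum_(k < 3) f k = f 0%N + f 1%N + f 2%N.
  by rewrite !big_ord_recr big_ord0 /= add0r.
pose term k := '[nth 0 [:: rc; rcx; rcy] k, nth 0 [:: r p; rx p; ry p] k]
               / nth 0 [:: 1; E p; E p] k.
rewrite detE// [X in _ * X = _](eq_bigr (fun k : 'I_3 => term k)); last first.
  by move=> k _; rewrite !rowK mxE.
rewrite (sum3 term) {}/term [X in _ * X = _]/= rcr mul0r add0r => h.
have cancel (X Y F e A B : C) : F != 0 -> e != 0 ->
    F * e * (X / F + Y / F) = A * e + F * (B * e) -> X + Y = A + B * F.
  move=> F0 en0 XY; apply: (mulIf en0).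
  have -> : (X + Y) * e = F * e * (X / F + Y / F) by field.
  by rewrite XY; ring.
exact: (cancel _ _ _ _ _ _ E0 (expi_neq0 _) h).
Qed.

(** Differentiating <rb, rb> = E along [a] and <rb, ra> = 0 along [b] shows that
    E has derivative <rab, rb> - <rbb, ra> along [a].  The symmetry of second
    derivatives enters through the hypothesis that [rab] is at once the
    derivative of [ra] along [b] and of [rb] along [a].  The constant [k] stands
    for i beta_a E. *)
Lemma laplacian_tangential U a b p (ra rb : R * R -> 'rV[C]_3) raa rab rbb
    (E : R * R -> C) (k : C) : open U -> U p ->
  (forall q, U q -> '[rb q, rb q] = E q /\ '[rb q, ra q] = 0) ->
  is_dM b p ra rab -> is_dM a p rb rab -> is_dM b p rb rbb ->
  (forall Ea, is_dC a p E Ea -> '[raa, ra p] + '[rab, rb p] = Ea + k) ->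
  '[raa + rbb, ra p] = k.
Proof.
move=> oU Up gram dra drab drb angle.
have dE : is_dC a p E ('[rab, rb p] + '[rb p, rab]).
  apply: (is_dC_open oU Up _ (is_dC_dotmx drab drab)).
  by move=> q /gram[].
have orth : '[rbb, ra p] + '[rb p, rab] = 0.
  apply: is_dC_unique (is_dC_cst b p 0).
  apply: (is_dC_open oU Up _ (is_dC_dotmx drb dra)).
  by move=> q /gram[].
have cancel (A B D F : C) : B + D = 0 -> A + F = F + D + k -> A + B = k.
  by move=> /eqP; rewrite addr_eq0 => /eqP -> AF; apply: (addIr F);
    rewrite addrAC AF; ring.
by rewrite dotmxDl; exact: (cancel _ _ _ _ orth (angle _ dE)).
Qed.

Lemma normal_second_derivative U a p (r ra : R * R -> 'rV[C]_3) raa (e : C) :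
  open U -> U p -> (forall q, U q -> '[ra q, r q] = 0) -> '[ra p, ra p] = e ->
  is_dM a p r (ra p) -> is_dM a p ra raa -> '[raa, r p] = - e.
Proof.
move=> oU Up rar <- dr dra; apply/eqP; rewrite -addr_eq0; apply/eqP.
apply: is_dC_unique (is_dC_cst a p 0).
exact: (is_dC_open oU Up rar (is_dC_dotmx dra dr)).
Qed.

(** The left-hand side of [angle_derivative] is symmetric in r_x and r_y, so that
    [laplacian_tangential] applies with x and y in either role;
    [frame_expansion] then assembles the three products. *)
Lemma conformal_laplacian U p (r : R * R -> 'rV[C]_3) (E : R * R -> C)
    (beta : R * R -> R) :
  open U -> U p -> smooth_mx_on U r ->
  (forall q, U q -> '[r q, r q] = 1) ->
  (forall q, U q -> [/\ '[r q, dM (dirx R) r q] = 0,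
     '[r q, dM (diry R) r q] = 0 & '[dM (dirx R) r q, dM (diry R) r q] = 0]) ->
  (forall q, U q ->
     '[dM (dirx R) r q, dM (dirx R) r q] = E q /\
     '[dM (diry R) r q, dM (diry R) r q] = E q) ->
  E p != 0 -> differentiable beta p ->
  (forall q, U q ->
     \det (rows3 (r q) (dM (dirx R) r q) (dM (diry R) r q)) =
     E q * expi (beta q)) ->
  dM (dirx R) (dM (dirx R) r) p + dM (diry R) (dM (diry R) r) p =
  (- E p - E p) *: r p
  + ('i%C * ('D_(dirx R) beta p)%:C) *: dM (dirx R) r p
  + ('i%C * ('D_(diry R) beta p)%:C) *: dM (diry R) r p.
Proof.
move=> oU Up sr r1 orth gram E0 dbeta detE.
have [srx sry] := smooth_dM sr.
pose x := dirx R; pose y := diry R; pose rx := dM x r; pose ry := dM y r.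
have [rrx rry rxy] := orth p Up; have [rxx ryy] := gram p Up.
have mixed : dM y rx p = dM x ry p := dM_sym oU Up sr.
have dr a : is_dM a p r (dM a r p) := smooth_is_dM a sr Up.
have drx a : is_dM a p rx (dM a rx p) := smooth_is_dM a srx Up.
have dry a : is_dM a p ry (dM a ry p) := smooth_is_dM a sry Up.
have gram3 q : U q -> [/\ '[r q, r q] = 1, '[rx q, rx q] = E q &
                        '[ry q, ry q] = E q].
  by move=> Uq; have [h1 h2] := gram q Uq; exact: And3 (r1 q Uq) h1 h2.
have angle a Ea : '[dM a r p, r p] = 0 -> is_dC a p E Ea ->
    '[dM a rx p, rx p] + '[dM a ry p, ry p] =
    Ea + 'i%C * ('D_a beta p)%:C * E p.
  move=> ar dE; have dba : is_derive p a beta ('D_a beta p).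
    by apply: derivableP; exact: diff_derivable.
  exact: (angle_derivative oU Up gram3 orth detE E0
    (dr a) (drx a) (dry a) dE dba ar).
have [orx ory oxy] : [/\ forall q, U q -> '[rx q, r q] = 0,
    forall q, U q -> '[ry q, r q] = 0 & forall q, U q -> '[ry q, rx q] = 0].
  by split=> q Uq; have [h1 h2 h3] := orth q Uq; apply: dotmx_eq0_sym;
    [exact: h1|exact: h2|exact: h3].
have dxy : is_dM y p rx (dM x ry p) by rewrite -mixed; exact: drx.
have dyx : is_dM x p ry (dM y rx p) by rewrite mixed; exact: dry.
have tx := laplacian_tangential oU Up
  (fun q Uq => conj (proj2 (gram q Uq)) (oxy q Uq))
  dxy (dry x) (dry y) (fun Ea => angle x Ea (orx p Up)).
(* Here the roles of x and y are exchanged: ra is r_y and rb is r_x. *)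
have ty := laplacian_tangential oU Up
  (fun q Uq => conj (proj1 (gram q Uq)) (dotmx_eq0_sym (oxy q Uq)))
  dyx (drx y) (drx x)
  (fun Ea dE => etrans (addrC _ _) (angle y Ea (ory p Up) dE)).
have nx := normal_second_derivative oU Up orx rxx (dr x) (drx x).
have ny := normal_second_derivative oU Up ory ryy (dr y) (dry y).
have n : '[dM x rx p + dM y ry p, r p] = - E p - E p.
  exact: etrans (dotmxDl _ _ _) (f_equal2 +%R nx ny).
have G0 : \det (rows3 (r p) (rx p) (ry p)) != 0.
  by rewrite (detE p Up); exact: mulf_neq0 E0 (expi_neq0 _).
rewrite addrC in ty.
exact: (frame_expansion G0 (r1 p Up) rxx ryy rrx rry rxy n tx ty).
Qed.
End PlaneDerivatives.

(* [U] ranges over the open subsets of [Omega] (including [Omega] itself)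
   because the Lagrangian angle is in general only locally a smooth function. *)
Theorem lemma1 (R : realType) (Omega : set (R * R))
    (r : R * R -> 'rV[R[i]]_3) (v : R * R -> R)
    (U : set (R * R)) (beta : R * R -> R)
    (Omega_open : open Omega) (Omega_connected : connected Omega)
    (Omega_nonempty : Omega !=set0)
    (r_smooth : smooth_mx_on Omega r)
    (r_S5 : forall p, Omega p -> S5 (r p))
    (r_horizontal : horizontal Omega r)
    (phi_immersion : immersion Omega (@hopf R \o r))
    (phi_conformal : conformal Omega (@hopf R \o r))
    (phi_lagrangian : lagrangian Omega (@hopf R \o r))
    (v_smooth : smooth_on Omega v)
    (v_metric : induced_metric Omega (@hopf R \o r) v)
    (U_open : open U) (U_sub : U `<=` Omega)
    (beta_angle : lagrangian_angle U r beta) :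
  forall (j : 'I_3) (p : R * R), U p ->
    schrodinger v beta (fun q => r q ord0 j) p = 0.
Proof.
have [beta_smooth beta_det] := beta_angle.
pose x := dirx R; pose y := diry R; pose rx := dM x r; pose ry := dM y r.
pose E q : R[i] := (2 * expR (v q))%:C.
have dr a q : Omega q -> is_dM a q r (dM a r q) := smooth_is_dM a r_smooth.
have metric a b q : Omega q -> '[r q, dM a r q] = 0 -> '[r q, dM b r q] = 0 ->
    '[dM a r q, dM b r q] = (2 * expR (v q) * dot2 a b)%:C.
  move=> Oq ra rb.
  have := dotmx_pullback (r_S5 q Oq) (dr a q Oq) (dr b q Oq) ra rb.
  by rewrite (v_metric q Oq a b) (phi_lagrangian q Oq a b) oppr0.
have E_gt0 q : 0 < 2 * expR (v q) by rewrite mulr_gt0 ?expR_gt0.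
have r1 q : U q -> '[r q, r q] = 1 by move=> /U_sub /r_S5.
have orth q : U q ->
    [/\ '[r q, rx q] = 0, '[r q, ry q] = 0 & '[rx q, ry q] = 0].
  move=> /U_sub Oq; have [hx hy] := r_horizontal q Oq.
  have hxy := metric x y q Oq hx hy.
  have dxy : dot2 x y = 0 by rewrite /dot2 /= mulr0 mul0r addr0.
  rewrite dxy mulr0 in hxy.
  exact: And3 hx hy hxy.
have gram q : U q -> '[rx q, rx q] = E q /\ '[ry q, ry q] = E q.
  move=> /U_sub Oq; have [hx hy] := r_horizontal q Oq.
  have hxx := metric x x q Oq hx hx.
  have hyy := metric y y q Oq hy hy.
  have dxx : dot2 x x = 1 by rewrite /dot2 /= mulr1 mulr0 addr0.
  have dyy : dot2 y y = 1 by rewrite /dot2 /= mulr1 mulr0 add0r.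
  rewrite dxx mulr1 in hxx; rewrite dyy mulr1 in hyy.
  exact: conj hxx hyy.
have detE q : U q -> \det (rows3 (r q) (rx q) (ry q)) = E q * expi (beta q).
  move=> Uq; have [gx gy] := gram q Uq; rewrite (beta_det q Uq).
  exact: det_frame (E_gt0 q) gx gy.
move=> j p Up.
have E0 : E p != 0.
  by rewrite /E -[0]/(0%:C) (inj_eq (@complexI R)); exact: lt0r_neq0.
have dbeta : differentiable beta p.
  by have [h _ _] := beta_smooth 1%N; exact: h.
have smoothU := smooth_mx_on_sub U_sub r_smooth.
have L := conformal_laplacian U_open Up smoothU r1 orth gram E0 dbeta detE.
pose f q := r q ord0 j.
have first a q : dM a r q ord0 j = dC a f q by rewrite mxE.
have second a b : dM a (dM b r) p ord0 j = dC a (dC b f) p.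
  by rewrite mxE (_ : (fun q => _) = dC b f)//; apply/funext => q; exact: first.
have Lj : dC x (dC x f) p + dC y (dC y f) p =
    (- E p - E p) * f p + ('i%C * ('D_x beta p)%:C) * dC x f p
    + ('i%C * ('D_y beta p)%:C) * dC y f p.
  have entry (k s t : R[i]) (d d' a b c : 'rV[R[i]]_3) :
      d + d' = k *: a + s *: b + t *: c ->
      d ord0 j + d' ord0 j = k * a ord0 j + s * b ord0 j + t * c ord0 j.
    by move=> /matrixP/(_ ord0 j); rewrite !mxE.
  rewrite -(second x x) -(second y y) -(first x p) -(first y p).
  exact: entry L.
have fourE : (4 * expR (v p))%:C = E p + E p :> R[i].
  by rewrite /E -rmorphD; congr (_%:C); ring.
have cancel (e i s t a b c : R[i]) :
  (- e - e) * a + i * s * b + i * t * c - i * (s * b + t * c) + (e + e) * a = 0.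
  by ring.
by rewrite /schrodinger Lj fourE; exact: cancel.
Qed.
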